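(* Let $E$ be a complex normed space, and suppose that $1\le p\le q<\infty$. For $n\in\mathbb N$ and $x_1,\dots,x_n\in E$, set $$\|(x_1,\dots,x_n)\|_n^{(p,q)}=\sup\Big\{\Big(\sum_{i=1}^n|\langle x_i,\lambda_i\rangle|^q\Big)^{1/q}:\lambda_1,\dots,\lambda_n\in E',\ \mu_{p,n}(\lambda_1,\dots,\lambda_n)\le1\Big\}.$$ Then the sequence $(\|\cdot\|_n^{(p,q)}:n\in\mathbb N)$ is a multi-norm based on $E$.
   Context: $\mu_{p,n}$ is the weak $p$-summing norm on $(E')^n$: $\mu_{p,n}(\lambda_1,\dots,\lambda_n)=\sup\{(\sum_{j=1}^n|\langle\Lambda,\lambda_j\rangle|^p)^{1/p}:\Lambda\in E'',\|\Lambda\|\le1\}$, which equals $\sup\{(\sum_{j=1}^n|\langle x,\lambda_j\rangle|^p)^{1/p}:x\in E,\|x\|\le1\}$. A multi-norm based on a complex normed space $(E,\|\cdot\|)$ is a sequence $(\|\cdot\|_k:k\in\mathbb N)$, with $\|\cdot\|_k$ a norm on $E^k$ and $\|x\|_1=\|x\|$, such that for each $k\ge2$: (A1) $\|(x_{\sigma(1)},\dots,x_{\sigma(k)})\|_k=\|(x_1,\dots,x_k)\|_k$ for each permutation $\sigma$ of $\{1,\dots,k\}$; (A2) $\|(\alpha_1x_1,\dots,\alpha_kx_k)\|_k\le(\max_i|\alpha_i|)\|(x_1,\dots,x_k)\|_k$ for $\alpha_i\in\mathbb C$; (A3) $\|(x_1,\dots,x_{k-1},0)\|_k=\|(x_1,\dots,x_{k-1})\|_{k-1}$;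 (A4) $\|(x_1,\dots,x_{k-2},x_{k-1},x_{k-1})\|_k=\|(x_1,\dots,x_{k-1})\|_{k-1}$, for all $x_i\in E$. *)

(* Defs.v *)
From HB Require Import structures.
From mathcomp Require Import all_boot all_order all_algebra.
From mathcomp Require Import perm complex.
From mathcomp Require Import all_classical all_reals all_analysis.

Set Implicit Arguments.
Unset Strict Implicit.
Unset Printing Implicit Defensive.

Import Order.TTheory GRing.Theory Num.Theory.
Import numFieldNormedType.Exports.

Local Open Scope classical_set_scope.
Local Open Scope ring_scope.
Local Open Scope complex_scope.

(* The norm of a normed module over R[i] takes its values in R[i];
   [rnorm] is the same norm with values in R (see [rnormE]). *)
Definition rnorm (R : realType) (E : normedModType R[i]) (x : E) : R :=
  complex.Re `|x|.

Section RealNorm.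
Variables (R : realType) (E : normedModType R[i]).
Implicit Types x y : E.

Lemma rnormE x : `|x| = (rnorm x)%:C.
Proof. by rewrite /rnorm RRe_real// normr_real. Qed.

Lemma rnorm_ge0 x : 0 <= rnorm x.
Proof. by rewrite -lecR -rnormE normr_ge0. Qed.

Lemma ler_rnormD x y : rnorm (x + y) <= rnorm x + rnorm y.
Proof. by rewrite -lecR rmorphD/= -!rnormE ler_normD. Qed.

Lemma rnormZ (a : R[i]) x : rnorm (a *: x) = rnorm (a : R[i]^o) * rnorm x.
Proof.
by apply: (@complexI R); rewrite rmorphM/= -!rnormE normrZ.
Qed.

Lemma rnorm_eq0 x : rnorm x = 0 -> x = 0.
Proof. by move=> x0; apply/normr0_eq0; rewrite rnormE x0. Qed.

Lemma rnorm0 : rnorm (0 : E) = 0.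
Proof. by rewrite /rnorm normr0. Qed.

End RealNorm.

Section ContinuousLinear.
Variables (R : realType) (E : normedModType R[i]).

Definition continuous_linear : {pred E -> R[i]^o} :=
  [pred f : E -> R[i]^o | `[< linear f /\ continuous f >]].

Lemma continuous_linear_submod : submod_closed continuous_linear.
Proof.
split=> [|a f g].
  apply/asboolP; split=> [b x y|x].
    by rewrite /GRing.zero/= scaler0 addr0.
  exact: cst_continuous.
move=> /asboolP[lf cf] /asboolP[lg cg]; apply/asboolP.
split=> [b x y|x].
  rewrite !addrfctE !scalrfctE lf lg !scalerDr !scalerA (mulrC a b) -!addrA.
  by congr (_ + _); rewrite addrCA.
by apply: cvgD; [apply: cvgZr; exact: cf|exact: cg].
Qed.

HB.instance Definition _ :=
  GRing.isSubmodClosed.Build R[i] (E -> R[i]^o) continuous_linear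
    continuous_linear_submod.

End ContinuousLinear.

(* The dual space E' of continuous linear functionals, made below into a
   normed space under the operator norm, so that E'' is [dual (dual E)]. *)
Record dual (R : realType) (E : normedModType R[i]) := Dual {
  dual_fun :> E -> R[i]^o;
  dual_mem : dual_fun \in @continuous_linear R E }.

Section DualNormed.
Variables (R : realType) (E : normedModType R[i]).

HB.instance Definition _ := [isSub for @dual_fun R E].
HB.instance Definition _ := [Choice of dual E by <:].
HB.instance Definition _ := [SubChoice_isSubZmodule of dual E by <:].
HB.instance Definition _ := [SubZmodule_isSubLmodule of dual E by <:].

Lemma dual_linear (f : dual E) : linear f.
Proof. by have /asboolP[] := dual_mem f. Qed.

Lemma dual_continuous (f : dual E) : continuous f.
Proof. by have /asboolP[] := dual_mem f. Qed.

HB.instance Definition _ (f : dual E) :=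
  GRing.isLinear.Build R[i] E R[i]^o *:%R (f : E -> R[i]^o) (dual_linear f).

Lemma dualDE (f g : dual E) x : (f + g) x = f x + g x.
Proof. by []. Qed.

Lemma dualZE (a : R[i]) (f : dual E) x : (a *: f) x = a *: f x.
Proof. by []. Qed.

Definition opnorm (f : dual E) : R :=
  sup [set rnorm (f x) | x in [set x : E | rnorm x <= 1]].

Lemma opnorm_has_sup (f : dual E) :
  has_sup [set rnorm (f x) | x in [set x : E | rnorm x <= 1]].
Proof.
split; first by exists (rnorm (f 0)), 0; rewrite //= rnorm0.
have /linear_bounded_continuous/linear_boundedP := @dual_continuous f.
move=> /pinfty_ex_gt0[M M0 fM].
exists (complex.Re M) => _ [x /= x1 <-].
have MR : M = (complex.Re M)%:C by rewrite RRe_real// gtr0_real.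
have := fM x; rewrite !rnormE MR -rmorphM/= lecR => /le_trans; apply.
by rewrite ler_piMr// -lecR -MR ltW.
Qed.

Lemma opnorm_ub (f : dual E) x : rnorm x <= 1 -> rnorm (f x) <= opnorm f.
Proof.
by move=> x1; apply: ub_le_sup; [case: (opnorm_has_sup f)|exists x].
Qed.

Lemma opnorm_le (f : dual E) (M : R) :
  (forall x, rnorm x <= 1 -> rnorm (f x) <= M) -> opnorm f <= M.
Proof.
move=> fM; apply: ge_sup; first by case: (opnorm_has_sup f).
by move=> _ [x /= /fM + <-].
Qed.

Lemma opnorm_ge0 (f : dual E) : 0 <= opnorm f.
Proof.
by apply: le_trans (@opnorm_ub f 0 _); rewrite ?rnorm_ge0// rnorm0.
Qed.

Lemma ler_opnorm (f : dual E) x : rnorm (f x) <= opnorm f * rnorm x.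
Proof.
have [->|x0] := eqVneq x 0; first by rewrite linear0 !rnorm0 mulr0.
have nx0 : 0 < rnorm x.
  by rewrite lt_neqAle rnorm_ge0 andbT eq_sym; apply: contra_neq x0; exact: rnorm_eq0.
have rV : rnorm (((rnorm x)^-1)%:C : R[i]^o) = (rnorm x)^-1.
  apply: (@complexI R); rewrite -rnormE ger0_norm//.
  by rewrite lecR invr_ge0 rnorm_ge0.
have := @opnorm_ub f (((rnorm x)^-1)%:C *: x).
rewrite linearZ/= !rnormZ !rV mulVf ?gt_eqF// lexx => /(_ isT).
by rewrite mulrC ler_pdivrMr.
Qed.

Lemma ler_opnormD (f g : dual E) : opnorm (f + g) <= opnorm f + opnorm g.
Proof.
apply: opnorm_le => x x1; rewrite dualDE (le_trans (ler_rnormD _ _))//.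
by rewrite lerD// opnorm_ub.
Qed.

Lemma opnormZ (a : R[i]) (f : dual E) :
  opnorm (a *: f) = rnorm (a : R[i]^o) * opnorm f.
Proof.
have le b g : opnorm (b *: g) <= rnorm (b : R[i]^o) * opnorm g.
  apply: opnorm_le => x x1.
  by rewrite dualZE rnormZ ler_wpM2l ?rnorm_ge0// opnorm_ub.
apply/eqP; rewrite eq_le le/=.
have [->|a0] := eqVneq a 0; first by rewrite rnorm0 mul0r opnorm_ge0.
have := le a^-1 (a *: f); rewrite scalerA mulVf// scale1r.
have ra0 : 0 < rnorm (a : R[i]^o).
  rewrite lt_neqAle rnorm_ge0 andbT eq_sym.
  by apply: contra_neq a0 => /rnorm_eq0.
have -> : rnorm (a^-1 : R[i]^o) = (rnorm (a : R[i]^o))^-1.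
  by apply: (@complexI R); rewrite -rnormE normfV rnormE fmorphV.
by rewrite ler_pdivlMl.
Qed.

Lemma opnorm_eq0 (f : dual E) : opnorm f = 0 -> f = 0.
Proof.
move=> f0; apply: val_inj; apply/funext => x; apply: rnorm_eq0.
by apply/eqP; rewrite eq_le rnorm_ge0 andbT (le_trans (ler_opnorm _ _))// f0 mul0r.
Qed.

Let norm (f : dual E) : R[i] := (opnorm f)%:C.

Let ler_normD f g : norm (f + g) <= norm f + norm g.
Proof. by rewrite -rmorphD/= lecR ler_opnormD. Qed.

Let normrZ (a : R[i]) f : norm (a *: f) = `|a| * norm f.
Proof. by rewrite /norm opnormZ rmorphM/= -rnormE. Qed.

Let normr0_eq0 f : norm f = 0 -> f = 0.
Proof. by move=> /complexI/opnorm_eq0. Qed.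

HB.instance Definition _ := Lmodule_isNormed.Build R[i] (dual E)
  ler_normD normrZ normr0_eq0.

Lemma rnorm_dual (f : dual E) : rnorm f = opnorm f.
Proof. by []. Qed.

End DualNormed.

(* mu_{p,n} on (E')^n. *)
Definition weak_summing_norm (R : realType) (E : normedModType R[i]) (p : R)
    (n : nat) (l : 'I_n -> dual E) : \bar R :=
  ereal_sup [set ((\sum_(j < n) rnorm (L (l j)) `^ p) `^ p^-1)%:E
            | L in [set L : dual (dual E) | rnorm L <= 1]].

(* ||(x_1, ..., x_n)||_n^{(p,q)}, with values a priori in [0, +oo]: the
   real-valued [sup] would silently be 0 on an unbounded set. *)
Definition pq_norm (R : realType) (E : normedModType R[i]) (p q : R)
    (n : nat) (x : {ffun 'I_n -> E}) : \bar R :=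
  ereal_sup [set ((\sum_(i < n) rnorm (l i (x i)) `^ q) `^ q^-1)%:E
            | l in [set l : 'I_n -> dual E
                   | (weak_summing_norm p l <= 1)%E]].

Definition is_norm (R : realType) (V : lmodType R[i]) (N : V -> R) : Prop :=
  [/\ forall x y : V, N (x + y) <= N x + N y,
      forall (a : R[i]) (x : V), N (a *: x) = rnorm (a : R[i]^o) * N x
    & forall x : V, N x = 0 -> x = 0].

(* (x_1, ..., x_m, y) *)
Definition ffun_rcons (T : Type) (m : nat) (x : {ffun 'I_m -> T}) (y : T) :
    {ffun 'I_m.+1 -> T} :=
  [ffun i => if unlift ord_max i is Some j then x j else y].

(* The k-th norm is N k for k >= 1; the value N 0 plays no role.  The four
   axioms required at each level k >= 2 are stated with k = m.+2. *)
Record multi_norm (R : realType) (E : normedModType R[i])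
    (N : forall k : nat, {ffun 'I_k -> E} -> R) : Prop := MultiNorm {
  multi_norm_is_norm : forall k, (0 < k)%N -> is_norm (N k);
  multi_norm1 : forall x : E, N 1%N [ffun=> x] = rnorm x;
  multi_normA1 : forall m (s : 'S_m.+2) (x : {ffun 'I_m.+2 -> E}),
    N m.+2 [ffun i => x (s i)] = N m.+2 x;
  multi_normA2 : forall m (a : 'I_m.+2 -> R[i]) (x : {ffun 'I_m.+2 -> E}),
    N m.+2 [ffun i => a i *: x i] <=
      (\big[Order.max/0]_(i < m.+2) rnorm (a i : R[i]^o)) * N m.+2 x;
  multi_normA3 : forall m (x : {ffun 'I_m.+1 -> E}),
    N m.+2 (ffun_rcons x 0) = N m.+1 x;
  multi_normA4 : forall m (x : {ffun 'I_m.+1 -> E}),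
    N m.+2 (ffun_rcons x (x ord_max)) = N m.+1 x }.

(* Main.v *)
Require Import Defs.
From HB Require Import structures.
From mathcomp Require Import all_boot all_order all_algebra.
From mathcomp Require Import perm complex ring lra.
From mathcomp Require Import all_classical all_reals all_analysis.

(* Call l admissible when mu_{p,n}(l) <= 1. The axioms other than (A4) and
   ||x||_1 = ||x|| come from transporting an admissible l along the operation
   on x (permuting it, extending it by 0, restricting it) and, for the triangle
   inequality, from Minkowski's inequality in l^q.

   For (A4), if f and g are the last two entries of an admissible l and both
   are evaluated at x, replace them by the single functional h = a f + b g with
   (a, b) the Hoelder extremal for (f(x), g(x)): then
   |h(x)|^p = |f(x)|^p + |g(x)|^p, which dominates the l^q sum because p <= q,
   while |L(h)|^p <= |L(f)|^p + |L(g)|^p for every L in E'', so that the shorter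
   family is still admissible.

   ||x||_1 = ||x|| and definiteness need a norming functional for x. A sublinear
   functional that is minimal for the pointwise order is linear, so Hahn-Banach
   follows from Zorn's lemma applied to sublinear functionals, with no partial
   extensions; the complex case takes f(x) = u(x) - i u(i x). *)

Set Implicit Arguments.
Unset Strict Implicit.
Unset Printing Implicit Defensive.

Import Order.TTheory GRing.Theory Num.Theory.
Import numFieldNormedType.Exports.

Local Open Scope classical_set_scope.
Local Open Scope ring_scope.
Local Open Scope complex_scope.

(** * Sublinear functionals and the real Hahn-Banach theorem *)

Section HahnBanach.
Context {R : realType} {V : lmodType R}.
Implicit Types (p : V -> R) (x y : V) (t : R).

Definition sublinear p : Prop :=
  (forall x y, p (x + y) <= p x + p y) /\
  (forall t x, 0 < t -> p (t *: x) <= t * p x).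

Lemma sublinearZ p t x : sublinear p -> 0 < t -> p (t *: x) = t * p x.
Proof.
move=> [_ pZ] t0; apply/le_anti; rewrite pZ//= -ler_pdivlMl//.
by rewrite -[x in p x](scalerK (lt0r_neq0 t0)) pZ ?invr_gt0.
Qed.

Lemma sublinear0 p : sublinear p -> p 0 = 0.
Proof.
move=> sp; have := sublinearZ 0 sp (ltr0Sn R 1).
by rewrite scaler0; lra.
Qed.

Lemma sublinearN p x : sublinear p -> - p (- x) <= p x.
Proof.
by move=> sp; have := sp.1 x (- x); rewrite subrr sublinear0//; lra.
Qed.

Let slope p y x : set R :=
  [set p (x + t *: y) - t * p y | t in [set t | 0 <= t]].

(** Subadditivity gives t p(y) = p(ty) <= p(x + ty) + p(-x). The slopes are thus bounded below, so
    that their [inf] is a true infimum. *)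
Let slope_lb p y x z : sublinear p -> slope p y x z -> - p (- x) <= z.
Proof.
move=> sp [t /= t0 <-]; move: t0; rewrite le_eqVlt => /predU1P[<-|t0].
  by rewrite scale0r addr0 mul0r subr0 sublinearN.
have := sp.1 (x + t *: y) (- x).
by rewrite addrAC subrr add0r (sublinearZ _ sp t0); lra.
Qed.

Let has_inf_slope p y x : sublinear p -> has_inf (slope p y x).
Proof.
move=> sp; split; first by exists (p (x + 0 *: y) - 0 * p y), 0 => /=.
by exists (- p (- x)) => z; exact: slope_lb.
Qed.

(* The largest sublinear functional below [p] whose value at [- y] is [- p y]. *)
Definition tilt p y x : R := inf (slope p y x).

Lemma tilt_le p y x t : sublinear p -> 0 <= t ->
  tilt p y x <= p (x + t *: y) - t * p y.
Proof.
move=> sp t0; apply: ge_inf; last by exists t.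
exact: (has_inf_slope _ _ sp).2.
Qed.

Lemma tilt_ge p y x z : sublinear p ->
  (forall t, 0 <= t -> z <= p (x + t *: y) - t * p y) -> z <= tilt p y x.
Proof.
move=> sp zle; apply: lb_le_inf; first exact: (has_inf_slope _ _ sp).1.
by move=> _ [t /= t0 <-]; exact: zle.
Qed.

Lemma tilt_dominated p y x : sublinear p -> tilt p y x <= p x.
Proof.
move=> sp; have := tilt_le y x sp (lexx 0).
by rewrite scale0r addr0 mul0r subr0.
Qed.

Lemma tiltN p y : sublinear p -> tilt p y (- y) <= - p y.
Proof.
move=> sp; have := tilt_le y (- y) sp ler01.
by rewrite scale1r addNr sublinear0// mul1r sub0r.
Qed.

(** A slope of x at s and a slope of z at r together dominate the slope of x + z at s + r; t times
    the slope of x at s is the slope of tx at ts. *)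
Lemma tilt_sublinear p y : sublinear p -> sublinear (tilt p y).
Proof.
move=> sp; split=> [x z|t x t0].
  rewrite -lerBlDr; apply: tilt_ge => // s s0.
  rewrite lerBlDr -lerBlDl; apply: tilt_ge => // r r0.
  rewrite lerBlDl (le_trans (@tilt_le _ _ _ (s + r) sp (addr_ge0 s0 r0)))//.
  have := sp.1 (x + s *: y) (z + r *: y).
  by rewrite addrACA -scalerDl; lra.
rewrite -ler_pdivrMl//; apply: tilt_ge => // s s0.
rewrite ler_pdivrMl// (le_trans (@tilt_le _ _ _ (t * s) sp _))//.
  by rewrite mulr_ge0// ltW.
by rewrite -scalerA -scalerDr (sublinearZ _ sp t0) mulrBr mulrA.
Qed.

(** Zorn's lemma for the reversed pointwise order on the sublinear functionals below p: a nonempty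
    chain is bounded by its pointwise infimum, which is finite because every member is at least
    -p(-x) at x. *)
Lemma exists_minimal_sublinear p : sublinear p ->
  exists f : V -> R, [/\ sublinear f, (forall x, f x <= p x) &
    forall g : V -> R, sublinear g -> (forall x, g x <= f x) -> g = f].
Proof.
move=> sp.
pose T := {f : V -> R | sublinear f /\ forall x, f x <= p x}.
pose rel_ge (f g : T) := `[< forall x, sval g x <= sval f x >].
have [||||[f [sf fp]] fmin] := @Zorn T rel_ge.
- by move=> f; apply/asboolP.
- move=> f g h /asboolP fg /asboolP gh; apply/asboolP => x.
  exact: le_trans (gh x) (fg x).
- move=> [f Pf] [g Pg] /asboolP/= fg /asboolP/= gf; apply/eq_exist.
  by apply/funext => x; apply/le_anti; rewrite fg gf.
- move=> A totA; have [[f0 Af0]|A0] := pselect (exists f, A f); last first.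
    (* The empty chain is bounded by p itself. *)
    exists (exist _ p (conj sp (fun x => lexx (p x)))) => f Af.
    by exfalso; apply: A0; exists f.
  pose S x := [set sval f x | f in A].
  have S_lb x : lbound (S x) (- p (- x)).
    move=> _ [[f [sf fp]] /= _ <-]; apply: le_trans (sublinearN x sf).
    by rewrite lerN2.
  have infS x : has_inf (S x).
    by split; [exists (sval f0 x), f0|exists (- p (- x))].
  have infS_le f x : A f -> inf (S x) <= sval f x.
    by move=> Af; apply: ge_inf; [exact: (infS x).2|exists f].
  have le_infS x z : (forall f, A f -> z <= sval f x) -> z <= inf (S x).
    move=> zle; apply: lb_le_inf; first exact: (infS x).1.
    by move=> _ [f Af <-]; exact: zle.
  have sg : sublinear (fun x => inf (S x)).
    split=> [x y|t x t0].
      rewrite -lerBlDr; apply: (le_infS) => f Af.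
      rewrite lerBlDr -lerBlDl; apply: (le_infS) => g Ag.
      rewrite lerBlDl.
      (* The infima at x and at y are approached by different members of the chain; the smaller of
         the two serves at both points. *)
      have [/asboolP fg|/asboolP gf] := totA f g Af Ag.
        apply: le_trans (infS_le g _ Ag) _.
        apply: le_trans ((svalP g).1.1 _ _) _.
        by rewrite lerD2r fg.
      apply: le_trans (infS_le f _ Af) _; apply: le_trans ((svalP f).1.1 _ _) _.
      by rewrite lerD2l gf.
    rewrite -ler_pdivrMl//; apply: (le_infS) => f Af; rewrite ler_pdivrMl//.
    by apply: le_trans (infS_le f _ Af) _; exact: (svalP f).1.2.
  have gp x : inf (S x) <= p x := le_trans (infS_le _ x Af0) ((svalP f0).2 x).
  exists (exist _ (fun x => inf (S x)) (conj sg gp)) => f Af.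
  by apply/asboolP => x; exact: infS_le.
exists f; split=> // g sg gf.
have gp x : g x <= p x := le_trans (gf x) (fp x).
apply: (congr1 sval (_ : exist _ g (conj sg gp) = exist _ f (conj sf fp) :> T)).
by apply: fmin; apply/asboolP.
Qed.

(** Minimality forces f to equal its own tilt along x, whence f(-x) <= -f(x). So f is odd, and an
    odd subadditive function is additive. *)
Lemma minimal_sublinear_linear (f : V -> R) : sublinear f ->
  (forall g : V -> R, sublinear g -> (forall x, g x <= f x) -> g = f) ->
  linear (f : V -> R^o).
Proof.
move=> sf fmin.
have fN x : f (- x) = - f x.
  apply/le_anti; apply/andP; split.
    rewrite -[in leLHS](fmin _ (tilt_sublinear x sf)) ?tiltN// => y.
    exact: tilt_dominated.
  by rewrite lerNl sublinearN.
have fD x y : f (x + y) = f x + f y.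
  apply/le_anti; rewrite sf.1/=.
  by have := sf.1 (- x) (- y); rewrite -opprD !fN; lra.
move=> t x y; rewrite fD; congr (_ + _); change (f (t *: x) = t * f x).
have [t0|t0|->] := ltgtP t 0; last by rewrite scale0r sublinear0// mul0r.
- by rewrite -[t]opprK scaleNr fN sublinearZ ?oppr_gt0// [RHS]mulNr.
- by rewrite sublinearZ.
Qed.

(* Tilting [p] along [x0] before minimising forces [f (- x0) <= - p x0]. *)
Lemma hahn_banach p (x0 : V) : sublinear p ->
  exists f : V -> R,
    [/\ linear (f : V -> R^o), (forall x, f x <= p x) & f x0 = p x0].
Proof.
move=> sp.
have [f [sf fp fmin]] := exists_minimal_sublinear (tilt_sublinear x0 sp).
have fle x : f x <= p x := le_trans (fp x) (tilt_dominated _ _ sp).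
exists f; split=> //; first exact: minimal_sublinear_linear.
apply/le_anti; rewrite fle/=.
have := le_trans (fp (- x0)) (tiltN x0 sp).
by have := sublinearN x0 sf; lra.
Qed.

End HahnBanach.

(** * Restriction of scalars, on a synonym of [E] that keeps the two scalings apart *)

Definition restrict_scalars (R : realType) (E : lmodType R[i]) : Type := E.

Section RestrictScalars.
Variables (R : realType) (E : lmodType R[i]).

HB.instance Definition _ := GRing.Zmodule.copy (restrict_scalars E) E.

Definition real_scale (t : R) (x : restrict_scalars E) : restrict_scalars E :=
  t%:C *: (x : E).

Let real_scaleA a b x : real_scale a (real_scale b x) = real_scale (a * b) x.
Proof. by rewrite /real_scale scalerA rmorphM. Qed.

Let real_scale1 : left_id 1 real_scale.
Proof. by move=> x; rewrite /real_scale scale1r. Qed.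

Let real_scaleDr : right_distributive real_scale +%R.
Proof. by move=> a x y; rewrite /real_scale scalerDr. Qed.

Let real_scaleDl x : {morph real_scale^~ x : a b / a + b}.
Proof. by move=> a b; rewrite /real_scale rmorphD scalerDl. Qed.

HB.instance Definition _ := GRing.Zmodule_isLmodule.Build R (restrict_scalars E)
  real_scaleA real_scale1 real_scaleDr real_scaleDl.

End RestrictScalars.

(** * Bounded and norming functionals on a complex normed space *)

Section Functionals.
Variables (R : realType) (E : normedModType R[i]).

Lemma rnormC (z : R[i]^o) : (rnorm z)%:C = `|z : R[i]|.
Proof. by rewrite -rnormE. Qed.

Lemma rnormM (a b : R[i]^o) : rnorm (a * b : R[i]^o) = rnorm a * rnorm b.
Proof. exact: rnormZ. Qed.

Lemma Re_le_rnorm (z : R[i]^o) : complex.Re z <= rnorm z.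
Proof.
by rewrite (le_trans (ler_norm _))// -lecR rnormC normc_ge_Re.
Qed.

(* [c = |z| / z]; at [z = 0] the division gives [c = 0]. *)
Lemma exists_phase (z : R[i]^o) :
  exists2 c : R[i]^o, rnorm c <= 1 & c * z = (rnorm z)%:C.
Proof.
exists (`|z| / z).
  rewrite -lecR rnormC normrM normfV normr_id.
  have [->|z0] := eqVneq z 0; rewrite ?normr0 ?mul0r ?ler01//.
  by rewrite divff ?normr_eq0.
rewrite rnormC.
by have [->|z0] := eqVneq z 0; rewrite ?normr0 ?mulr0// divfK.
Qed.

Lemma bounded_functional (f : E -> R[i]^o) (M : R) : linear f ->
  (forall x, rnorm (f x) <= M * rnorm x) -> f \in @continuous_linear R E.
Proof.
move=> lf fM; apply/asboolP; split=> //.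
pose F : {linear E -> R[i]^o} := HB.pack f (GRing.isLinear.Build _ _ _ _ f lf).
apply: (@bounded_linear_continuous R[i] E R[i]^o F).
apply/(linear_boundedP F); near=> r => x.
rewrite rnormE (le_trans (_ : _ <= M%:C * `|x|))//.
  by rewrite rnormE -rmorphM lecR fM.
rewrite ler_wpM2r//.
near: r; apply: nbhs_pinfty_ge; apply/complex_realP; exists M.
Unshelve. all: by end_near. Qed.

Lemma norming_functional (x0 : E) :
  exists2 f : dual E, opnorm f <= 1 & rnorm (f x0) = rnorm x0.
Proof.
have rnorm_sublinear : sublinear (fun x : restrict_scalars E => rnorm (x : E)).
  split=> [x y|t x t0]; first exact: ler_rnormD.
  rewrite /GRing.scale/= /real_scale rnormZ -lecR !rmorphM/= rnormC.
  by rewrite ger0_norm// lecR ltW.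
have [u [lu u_le ux0]] := hahn_banach (x0 : restrict_scalars E) rnorm_sublinear.
have uD x y : u (x + y) = u x + u y.
  by have := lu 1 x y; rewrite !scale1r.
have u0 : u 0 = 0 by have := uD 0 0; rewrite addr0; lra.
have uZ t (x : E) : u (t%:C *: x) = t * u x.
  by have := lu t x 0; rewrite addr0 u0 addr0.
(* A complex-linear functional with real part u must have this imaginary part, since Im F(x) = -Re
   F(ix). *)
pose F (x : E) : R[i]^o := u x +i* - u ('i *: x).
have lF : linear F.
  move=> [a1 a2] x y; rewrite /F.
  have -> : (a1 +i* a2) *: x + y = a1%:C *: x + a2%:C *: ('i *: x) + y.
    rewrite scalerA -scalerDl; congr (_ *: _ + _).
    by rewrite [LHS]complexE mulrC.
  have ia : 'i *: (a1%:C *: x + a2%:C *: ('i *: x) + y) =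
      a1%:C *: ('i *: x) + (- a2)%:C *: x + 'i *: y :> E.
    rewrite !scalerDr !scalerA mulrAC -expr2 sqr_i mulN1r rmorphN.
    by rewrite ['i * _]mulrC.
  rewrite ia !uD !uZ; apply/eqP; rewrite eq_complex/=.
  by apply/andP; split; apply/eqP; ring.
have F_le x : rnorm (F x) <= 1 * rnorm x.
  (* Rotating by the phase c makes F(cx) = |F(x)| real, hence equal to u(cx), where the bound on u
     applies. *)
  have [c c1 cF] := exists_phase (F x).
  have : u (c *: x) = rnorm (F x).
    have F0 : F 0 = 0 by rewrite /F scaler0 u0 oppr0.
    have := lF c x 0; rewrite !addr0 F0 addr0.
    by move=> Fc; have := congr1 (@complex.Re R) (etrans Fc cF).
  move=> <-; rewrite (le_trans (u_le _))// rnormZ.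
  by rewrite ler_wpM2r// rnorm_ge0.
exists (Dual (bounded_functional lF F_le)).
  by apply: opnorm_le => x x1; rewrite (le_trans (F_le x))// mul1r.
apply/le_anti; rewrite -[X in _ <= X]mul1r F_le/=.
by rewrite -ux0 (Re_le_rnorm (F x0)).
Qed.

End Functionals.

(** * Power inequalities, Hoelder extremals and Minkowski's inequality for finite sums *)

Section PowerSums.
Context {R : realType}.
Implicit Types (p q s t : R).

Lemma powRV_le q s t : 0 < q -> 0 <= s -> 0 <= t ->
  (s `^ q^-1 <= t) = (s <= t `^ q).
Proof.
move=> q0 s0 t0; apply/idP/idP => st.
  rewrite -[leLHS]powRr1// -(mulVf (lt0r_neq0 q0)) powRrM.
  by apply: ge0_ler_powR; rewrite ?nnegrE ?powR_ge0 ?(ltW q0).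
rewrite -[leRHS]powRr1// -(mulfV (lt0r_neq0 q0)) powRrM.
by apply: ge0_ler_powR; rewrite ?nnegrE ?powR_ge0 ?invr_ge0 ?(ltW q0).
Qed.

Lemma powRVK q s : 0 < q -> 0 <= s -> (s `^ q^-1) `^ q = s.
Proof. by move=> q0 s0; rewrite -powRrM mulVf ?gt_eqF// powRr1. Qed.

Lemma powRKV q s : 0 < q -> 0 <= s -> (s `^ q) `^ q^-1 = s.
Proof. by move=> q0 s0; rewrite -powRrM mulfV ?gt_eqF// powRr1. Qed.

Lemma powR_div p s t : 0 <= s -> 0 <= t -> (s / t) `^ p = s `^ p / t `^ p.
Proof.
move=> s0 t0; rewrite powRM ?invr_ge0// -powR_inv1// powRAC.
by rewrite powR_inv1 ?powR_ge0.
Qed.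

Lemma powR_le1 p s : 0 <= p -> 0 <= s -> s <= 1 -> s `^ p <= 1.
Proof.
move=> p0 s0 s1; have := ge0_ler_powR p0 _ _ s1.
by rewrite !nnegrE powR1; exact.
Qed.

(** Write (s + t)^q = s (s + t)^(q-1) + t (s + t)^(q-1) and bound s + t below by s and by t. *)
Lemma ler_powR_superadd q s t : 1 <= q -> 0 <= s -> 0 <= t ->
  s `^ q + t `^ q <= (s + t) `^ q.
Proof.
move=> q1 s0 t0; have q0 : 0 < q by lra.
rewrite -[leRHS]mulr_powRB1 ?addr_ge0// mulrDl.
by rewrite lerD// -[leLHS]mulr_powRB1// ler_wpM2l// ge0_ler_powR ?nnegrE//; lra.
Qed.

(* [(c, d)] is the Hoelder extremal for [(s, t)]. *)
Lemma hoelder2_extremal p s t : 1 <= p -> 0 <= s -> 0 <= t ->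
  exists c d, [/\ 0 <= c, 0 <= d, c * s + d * t = (s `^ p + t `^ p) `^ p^-1 &
    forall u v, 0 <= u -> 0 <= v -> c * u + d * v <= (u `^ p + v `^ p) `^ p^-1].
Proof.
move=> p1 s0 t0; have p0 : 0 < p by lra.
(* For p = 1 the conjugate exponent is infinite, and the coefficients are 1 and 1. *)
have [pE|pN1] := eqVneq p 1.
  exists 1, 1; split=> // [|u v u0 v0];
  by rewrite pE invr1 !mul1r !powRr1 ?addr_ge0.
pose q := p / (p - 1).
have p1' : 0 < p - 1 by rewrite subr_gt0 lt_neqAle eq_sym pN1.
have q0 : 0 < q by rewrite divr_gt0.
have pq : p^-1 + q^-1 = 1 by rewrite /q invf_div; field; lra.
pose D := s `^ p + t `^ p; have D0 : 0 <= D by rewrite addr_ge0 ?powR_ge0.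
have [DE|DN0] := eqVneq D 0.
  exists 0, 0; split=> // [|u v u0 v0]; rewrite !mul0r addr0 ?powR_ge0//.
  by rewrite -/D DE powR0// invr_eq0 gt_eqF.
(* As (p - 1) q = p, dividing s^(p-1) and t^(p-1) by w gives a pair of l^q norm 1, while its pairing
   with (s, t) is D / w = D^(1/p). *)
pose w := D `^ q^-1; have w0 : 0 < w by rewrite powR_gt0// lt_neqAle eq_sym DN0.
exists (s `^ (p - 1) / w), (t `^ (p - 1) / w); split=> [|||u v u0 v0].
- by rewrite divr_ge0 ?powR_ge0.
- by rewrite divr_ge0 ?powR_ge0.
- rewrite mulrAC [X in _ + X]mulrAC -mulrDl ![_ `^ (p - 1) * _]mulrC.
  rewrite !mulr_powRB1// -/D.
  have {1}-> : D = D `^ p^-1 * w by rewrite -powRD ?pq ?powRr1// oner_eq0.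
  by rewrite mulfK// gt_eqF.
- have cd : (s `^ (p - 1) / w) `^ q + (t `^ (p - 1) / w) `^ q = 1.
    have pow z : 0 <= z -> (z `^ (p - 1) / w) `^ q = z `^ p / D.
      move=> z0; rewrite powR_div ?powR_ge0 ?(ltW w0)// (powRVK q0 D0) -powRrM.
      by rewrite /q [(p - 1) * _]mulrC divfK// gt_eqF.
    by rewrite !pow// -mulrDl divff.
  have := @hoelder2 R u v _ _ p q u0 v0 _ _ p0 q0 pq.
  move=> /(_ (s `^ (p - 1) / w) (t `^ (p - 1) / w)).
  rewrite cd powR1 mulr1 [u * _]mulrC [v * _]mulrC.
  by apply; rewrite divr_ge0 ?powR_ge0 ?(ltW w0).
Qed.

Definition pnorm p n (a : 'I_n -> R) : R := (\sum_(i < n) a i `^ p) `^ p^-1.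

Lemma sum_powR_ge0 p n (a : 'I_n -> R) : 0 <= \sum_(i < n) a i `^ p.
Proof. by apply: sumr_ge0 => i _; exact: powR_ge0. Qed.

Lemma pnorm_le p n (a : 'I_n -> R) t : 0 < p -> 0 <= t ->
  (pnorm p a <= t) = (\sum_(i < n) a i `^ p <= t `^ p).
Proof. by move=> p0 t0; rewrite /pnorm powRV_le// sum_powR_ge0. Qed.

Lemma ler_pnorm p n (a b : 'I_n -> R) : 0 < p -> (forall i, 0 <= a i <= b i) ->
  pnorm p a <= pnorm p b.
Proof.
move=> p0 ab; rewrite pnorm_le ?powR_ge0// powRVK ?sum_powR_ge0//.
apply: ler_sum => i _; have /andP[a0 abi] := ab i.
by rewrite ge0_ler_powR ?nnegrE ?(ltW p0)// (le_trans a0).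
Qed.

Lemma pnormZ p n (a : 'I_n -> R) t : 0 < p -> 0 <= t -> (forall i, 0 <= a i) ->
  pnorm p (fun i => t * a i) = t * pnorm p a.
Proof.
move=> p0 t0 a0; rewrite -[t in RHS](powRKV p0 t0).
rewrite -powRM ?powR_ge0 ?sum_powR_ge0//.
by rewrite mulr_sumr; congr (_ `^ _); apply: eq_bigr => i _; rewrite powRM.
Qed.

(** By convexity of the p-th power: (a_i + b_i) / (A + B) is the convex combination of a_i / A and
    b_i / B with weights A / (A + B) and B / (A + B), and the sums of (a_i / A)^p and (b_i / B)^p
    are at most 1. *)
Lemma minkowski_sum p n (a b : 'I_n -> R) : 1 <= p ->
  (forall i, 0 <= a i) -> (forall i, 0 <= b i) ->
  pnorm p (fun i => a i + b i) <= pnorm p a + pnorm p b.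
Proof.
move=> p1 a0 b0; have p0 : 0 < p by lra.
(* The slack e makes A and B positive even when a norm vanishes. *)
apply/ler_addgt0Pr => e e0.
pose A := pnorm p a + e / 2; pose B := pnorm p b + e / 2.
have A0 : 0 < A by rewrite ltr_wpDl ?powR_ge0 ?divr_gt0.
have B0 : 0 < B by rewrite ltr_wpDl ?powR_ge0 ?divr_gt0.
have -> : pnorm p a + pnorm p b + e = A + B by rewrite /A /B addrACA -splitr.
have aA : \sum_(i < n) a i `^ p <= A `^ p.
  by rewrite -(pnorm_le _ p0 (ltW A0)) lerDl divr_ge0// ltW.
have bB : \sum_(i < n) b i `^ p <= B `^ p.
  by rewrite -(pnorm_le _ p0 (ltW B0)) lerDl divr_ge0// ltW.
clearbody A B; have AB0 : 0 < A + B by rewrite addr_gt0.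
have w01 : 0 <= A / (A + B) <= 1.
  by rewrite divr_ge0 ?(ltW A0) ?(ltW AB0)//= ler_pdivrMr// mul1r lerDl ltW.
have conv i : (a i + b i) `^ p <= (A + B) `^ p *
    (A / (A + B) * (a i `^ p / A `^ p) + B / (A + B) * (b i `^ p / B `^ p)).
  have aA0 : 0 <= a i / A by rewrite divr_ge0// ltW.
  have bB0 : 0 <= b i / B by rewrite divr_ge0// ltW.
  have /andP[w0 w1] := w01.
  have := @convex_powR R p p1 (Itv01 w0 w1) (a i / A) (b i / B).
  rewrite !inE/= !in_itv/= !andbT aA0 bB0 => /(_ isT isT).
  have wE : unstable.onem (A / (A + B)) = B / (A + B).
    by rewrite /unstable.onem; field; lra.
  have convE : A / (A + B) * (a i / A) + B / (A + B) * (b i / B) =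
      (a i + b i) / (A + B).
    by field; rewrite !gt_eqF.
  rewrite !convRE/= wE; set x := conv _ _ _; set y := (X in _ <= X -> _).
  have -> : x = (a i + b i) / (A + B) by rewrite -convE -wE.
  rewrite /y !powR_div ?addr_ge0 ?(ltW A0) ?(ltW B0) ?(ltW AB0)//.
  by rewrite ler_pdivrMr ?powR_gt0// mulrC.
rewrite pnorm_le ?(ltW AB0)//.
apply: le_trans (ler_sum _ (fun i _ => conv i)) _.
rewrite -mulr_sumr -[leRHS]mulr1 ler_wpM2l ?powR_ge0//.
rewrite big_split/= -!mulr_sumr -!mulr_suml.
have -> : 1 = A / (A + B) * 1 + B / (A + B) * 1 :> R by field; lra.
by rewrite lerD// ler_wpM2l ?divr_ge0 ?(ltW A0) ?(ltW B0) ?(ltW AB0)//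
  ler_pdivrMr ?powR_gt0// mul1r.
Qed.

End PowerSums.

(** * Entries of a tuple with one appended element *)

Section Rcons.
Context {T : Type}.

Lemma ffun_rcons_max m (x : {ffun 'I_m -> T}) y : ffun_rcons x y ord_max = y.
Proof. by rewrite ffunE unlift_none. Qed.

Lemma ffun_rcons_widen m (x : {ffun 'I_m -> T}) y i :
  ffun_rcons x y (widen_ord (leqnSn m) i) = x i.
Proof.
rewrite ffunE (_ : widen_ord _ i = lift ord_max i) ?liftK//.
by apply/val_inj; rewrite /= /bump leqNgt ltn_ord.
Qed.

End Rcons.

(** * Admissible families of functionals and the (p,q)-norm *)

Section PQNorm.
Context {R : realType} {E : normedModType R[i]} {p q : R}.
Hypotheses (p1 : 1 <= p) (pq : p <= q).

Let p0 : 0 < p := lt_le_trans ltr01 p1.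
Let q1 : 1 <= q := le_trans p1 pq.
Let q0 : 0 < q := lt_le_trans ltr01 q1.

Lemma ler_bidual (L : dual (dual E)) (f : dual E) : rnorm L <= 1 ->
  rnorm (L f) <= opnorm f.
Proof.
move=> L1; rewrite (le_trans (ler_opnorm L f))// -[leRHS]mul1r.
by rewrite ler_wpM2r ?opnorm_ge0.
Qed.

(** The canonical embedding of E into E'', which allows a condition over the unit ball of E'' to be
    tested at points of E. *)
Lemma bidual_eval (x : E) :
  exists2 L : dual (dual E), opnorm L <= rnorm x & forall f : dual E, L f = f x.
Proof.
have lev : linear (fun f : dual E => f x) by [].
have ev_le (f : dual E) : rnorm (f x) <= rnorm x * rnorm f.
  by rewrite mulrC; exact: ler_opnorm.
exists (Dual (bounded_functional lev ev_le)) => //.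
apply: opnorm_le => f f1; rewrite (le_trans (ev_le f))//.
by rewrite -[leRHS]mulr1 ler_wpM2l// rnorm_ge0.
Qed.

(** Admissibility freed of the supremum and of the p-th root. *)
Definition weakly_summing n (l : 'I_n -> dual E) : Prop :=
  forall L : dual (dual E), rnorm L <= 1 ->
    \sum_(j < n) rnorm (L (l j)) `^ p <= 1.

Lemma weakly_summingP n (l : 'I_n -> dual E) :
  (weak_summing_norm p l <= 1)%E <-> weakly_summing l.
Proof.
have pow1 L : ((\sum_(j < n) rnorm (L (l j)) `^ p) `^ p^-1 <= 1) =
    (\sum_(j < n) rnorm (L (l j)) `^ p <= 1).
  by rewrite powRV_le// ?sum_powR_ge0// powR1.
split=> [l1 L L1|lw].
  rewrite -pow1 -lee_fin; apply: le_trans l1; apply: ereal_sup_ubound.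
  by exists L.
apply: ge_ereal_sup => _ [L /= L1 <-]; rewrite lee_fin pow1.
exact: lw.
Qed.

Lemma weakly_summing0 n : weakly_summing (fun _ : 'I_n => 0 : dual E).
Proof.
by move=> L _; rewrite big1// => j _; rewrite linear0 rnorm0 powR0// gt_eqF.
Qed.

Lemma weakly_summing_opnorm n (l : 'I_n -> dual E) i : weakly_summing l ->
  opnorm (l i) <= 1.
Proof.
move=> lw; apply: opnorm_le => x x1.
have [L Lx LE] := bidual_eval x.
rewrite -LE -[leLHS](powRKV p0) ?rnorm_ge0// powRV_le ?powR_ge0// powR1.
apply: le_trans (lw L (le_trans Lx x1)); rewrite (bigD1 i)//= lerDl.
by apply: sumr_ge0 => j _; exact: powR_ge0.
Qed.

Lemma weakly_summing_apply n (l : 'I_n -> dual E) i x : weakly_summing l ->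
  rnorm (l i x) <= rnorm x.
Proof.
move=> /(@weakly_summing_opnorm _ _ i) li.
rewrite (le_trans (ler_opnorm _ _))//.
by rewrite -[leRHS]mul1r ler_wpM2r ?rnorm_ge0.
Qed.

Lemma combine_functionals (f g : dual E) (x : E) : exists h : dual E,
  rnorm (h x) = (rnorm (f x) `^ p + rnorm (g x) `^ p) `^ p^-1 /\
  forall L : dual (dual E),
    rnorm (L h) `^ p <= rnorm (L f) `^ p + rnorm (L g) `^ p.
Proof.
have [c [d [c0 d0 cd_eq cd_le]]] :=
  hoelder2_extremal p1 (rnorm_ge0 (f x)) (rnorm_ge0 (g x)).
have [a a1 af] := exists_phase (f x).
have [b b1 bg] := exists_phase (g x).
have rnormR (t : R) : 0 <= t -> rnorm (t%:C : R[i]^o) = t.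
  by move=> t0; apply: (@complexI R); rewrite rnormC ger0_norm ?lecR.
(* The phases a and b turn f(x) and g(x) into their moduli, so that nothing cancels at x; being of
   modulus at most 1, they do not spoil the bound for L. *)
exists ((c%:C * a) *: f + (d%:C * b) *: g); split.
  rewrite dualDE !dualZE -cd_eq /GRing.scale/= -!mulrA af bg.
  rewrite -!rmorphM -rmorphD/=.
  by rewrite rnormR// addr_ge0 ?mulr_ge0 ?rnorm_ge0.
move=> L; set S := leRHS; have S0 : 0 <= S by rewrite addr_ge0 ?powR_ge0.
rewrite -[S](powRVK p0 S0).
rewrite ge0_ler_powR ?nnegrE ?rnorm_ge0 ?powR_ge0 ?(ltW p0)//.
apply: le_trans (cd_le _ _ (rnorm_ge0 _) (rnorm_ge0 _)).
rewrite linearD !linearZ/= (le_trans (ler_rnormD _ _))// !rnormZ !rnormR//.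
by rewrite lerD// ler_wpM2r ?rnorm_ge0// ler_piMr.
Qed.

Lemma pq_normE n (x : {ffun 'I_n -> E}) :
  pq_norm p q x = ereal_sup [set (pnorm q (fun i => rnorm (l i (x i))))%:E
    | l in [set l : 'I_n -> dual E | weakly_summing l]].
Proof.
rewrite /pq_norm; congr ereal_sup; apply/seteqP.
by split=> _ [l /= lw <-]; exists l => //=; apply/weakly_summingP.
Qed.

(** The zero family bounds the supremum below by 0, and |l_i(x_i)| <= ||x_i|| bounds it above. Hence
    [fine] loses no information. *)
Lemma pq_norm_fin_num n (x : {ffun 'I_n -> E}) : pq_norm p q x \is a fin_num.
Proof.
rewrite pq_normE fin_numElt; apply/andP; split.
  apply: lt_le_trans (ltNyr 0) _.
  apply: le_trans (ereal_sup_ubound _); last first.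
    by exists (fun=> 0) => //; exact: weakly_summing0.
  by rewrite lee_fin powR_ge0.
apply: le_lt_trans (ltry (pnorm q (fun i => rnorm (x i)))).
apply: ge_ereal_sup => _ [l /= lw <-]; rewrite lee_fin ler_pnorm// => i.
by rewrite rnorm_ge0 weakly_summing_apply.
Qed.

Local Notation N x := (fine (pq_norm p q x)).

Lemma pq_norm_ub n (x : {ffun 'I_n -> E}) (l : 'I_n -> dual E) :
  weakly_summing l -> pnorm q (fun i => rnorm (l i (x i))) <= N x.
Proof.
move=> lw; rewrite -lee_fin fineK ?pq_norm_fin_num// pq_normE.
by apply: ereal_sup_ubound; exists l.
Qed.

Lemma pq_norm_le n (x : {ffun 'I_n -> E}) M :
  (forall l : 'I_n -> dual E, weakly_summing l ->
    pnorm q (fun i => rnorm (l i (x i))) <= M) -> N x <= M.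
Proof.
move=> lM; rewrite -lee_fin fineK ?pq_norm_fin_num// pq_normE.
by apply: ge_ereal_sup => _ [l /= lw <-]; rewrite lee_fin lM.
Qed.

Lemma pq_norm_ge0 n (x : {ffun 'I_n -> E}) : 0 <= N x.
Proof. exact: le_trans (powR_ge0 _ _) (pq_norm_ub _ (@weakly_summing0 n)). Qed.

(** Test with a norming functional of x_i in position i and 0 elsewhere. *)
Lemma pq_norm_ge_rnorm n (x : {ffun 'I_n -> E}) i : rnorm (x i) <= N x.
Proof.
have [f f1 fx] := norming_functional (x i).
pose l j := if j == i then f else 0.
have lw : weakly_summing l.
  move=> L L1; rewrite (bigD1 i)//= big1 => [|j /negPf ji]; last first.
    by rewrite /l ji linear0 rnorm0 powR0// gt_eqF.
  rewrite addr0 /l eqxx powR_le1 ?rnorm_ge0 ?(ltW p0)//.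
  exact: le_trans (ler_bidual f L1) f1.
apply: le_trans (pq_norm_ub x lw); rewrite -fx -[leLHS](powRKV q0) ?rnorm_ge0//.
rewrite ge0_ler_powR ?nnegrE ?powR_ge0 ?sum_powR_ge0 ?invr_ge0 ?(ltW q0)//.
by rewrite (bigD1 i)//= /l eqxx lerDl sumr_ge0// => j _; exact: powR_ge0.
Qed.

(** * The norm properties and the multi-norm axioms *)

Lemma pq_normD n (x y : {ffun 'I_n -> E}) : N (x + y) <= N x + N y.
Proof.
apply: pq_norm_le => l lw.
apply: le_trans (lerD (pq_norm_ub x lw) (pq_norm_ub y lw)).
apply: le_trans (minkowski_sum q1 _ _); do ?[by move=> i; exact: rnorm_ge0].
apply: ler_pnorm => // i; rewrite rnorm_ge0/= ffunE linearD.
exact: ler_rnormD.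
Qed.

(** Serves both homogeneity, with constant a, and (A2). *)
Lemma pq_norm_mul_le n (a : 'I_n -> R[i]) (x : {ffun 'I_n -> E}) M :
  0 <= M -> (forall i, rnorm (a i : R[i]^o) <= M) ->
  N [ffun i => a i *: x i] <= M * N x.
Proof.
move=> M0 aM; apply: pq_norm_le => l lw.
apply: le_trans (ler_wpM2l M0 (pq_norm_ub x lw)).
rewrite -pnormZ// => [|i]; last exact: rnorm_ge0.
apply: ler_pnorm => // i; rewrite rnorm_ge0/= ffunE linearZ/= rnormZ.
by rewrite ler_wpM2r ?rnorm_ge0.
Qed.

Lemma pq_norm_is_norm n : is_norm (fun x : {ffun 'I_n -> E} => N x).
Proof.
have NZ (a : R[i]) (x : {ffun 'I_n -> E}) :
    N (a *: x) <= rnorm (a : R[i]^o) * N x.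
  exact: pq_norm_mul_le (rnorm_ge0 _) (fun=> lexx _).
split; first exact: pq_normD.
- move=> a x; apply/le_anti; rewrite NZ/=.
  have [->|a0] := eqVneq a 0; first by rewrite rnorm0 mul0r pq_norm_ge0.
  (* The reverse inequality is [NZ] for the scalar 1/a and the vector ax. *)
  have aVa : rnorm (a : R[i]^o) * rnorm (a^-1 : R[i]^o) = 1.
    by rewrite -rnormM mulfV// /rnorm normr1.
  rewrite -{1}[x](scalerK a0) -[leRHS]mul1r -aVa -mulrA ler_wpM2l ?rnorm_ge0//.
- move=> x Nx0; apply/ffunP => i; rewrite ffunE; apply: rnorm_eq0.
  by apply/le_anti; rewrite rnorm_ge0 andbT -Nx0 pq_norm_ge_rnorm.
Qed.

Lemma pq_norm1 (x : E) : N ([ffun=> x] : {ffun 'I_1 -> E}) = rnorm x.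
Proof.
apply/le_anti/andP; split.
  apply: pq_norm_le => l lw; rewrite pnorm_le ?rnorm_ge0// big_ord1 ffunE.
  by rewrite ge0_ler_powR ?nnegrE ?rnorm_ge0 ?(ltW q0)// weakly_summing_apply.
by have := pq_norm_ge_rnorm ([ffun=> x] : {ffun 'I_1 -> E}) ord0; rewrite ffunE.
Qed.

Lemma pq_norm_perm n (s : 'S_n) (x : {ffun 'I_n -> E}) :
  N [ffun i => x (s i)] = N x.
Proof.
have perm_le (t : 'S_n) (y : {ffun 'I_n -> E}) : N [ffun i => y (t i)] <= N y.
  apply: pq_norm_le => l lw.
  have ltw : weakly_summing (fun i => l (t^-1%g i)).
    move=> L L1; apply: le_trans (lw L L1).
    by rewrite (reindex_inj (@perm_inj _ t)); under eq_bigr do rewrite permK.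
  apply: le_trans (pq_norm_ub y ltw).
  rewrite /pnorm [X in _ <= X `^ _](reindex_inj (@perm_inj _ t)).
  rewrite le_eqVlt; apply/predU1P; left; congr (_ `^ _).
  by apply: eq_bigr => i _; rewrite ffunE permK.
apply/le_anti/andP; split; first exact: perm_le.
(* The reverse inequality follows by permuting back with the inverse of s. *)
have xE : x = [ffun i => [ffun j => x (s j)] ((s^-1)%g i)].
  by apply/ffunP => i; rewrite !ffunE permKV.
by rewrite [in leLHS]xE; exact: perm_le.
Qed.

Lemma weakly_summing_rcons n (l : 'I_n -> dual E) : weakly_summing l ->
  weakly_summing (ffun_rcons (finfun l) 0).
Proof.
move=> lw L L1; rewrite big_ord_recr/= ffun_rcons_max linear0 rnorm0.
rewrite powR0 ?gt_eqF// addr0; apply: le_trans (lw L L1).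
by under eq_bigr do rewrite ffun_rcons_widen ffunE.
Qed.

(** A family extended by 0 does not see y; this is one half of both (A3) and (A4). *)
Lemma pq_norm_rcons_ge n (x : {ffun 'I_n -> E}) y : N x <= N (ffun_rcons x y).
Proof.
apply: pq_norm_le => l lw.
apply: le_trans (pq_norm_ub _ (weakly_summing_rcons lw)).
rewrite /pnorm big_ord_recr/= ffun_rcons_max rnorm0 powR0 ?gt_eqF// addr0.
by under [in leRHS]eq_bigr do rewrite !ffun_rcons_widen ffunE.
Qed.

Lemma pq_norm_rcons0 n (x : {ffun 'I_n -> E}) : N (ffun_rcons x 0) = N x.
Proof.
apply/le_anti; rewrite pq_norm_rcons_ge andbT; apply: pq_norm_le => l lw.
have lw' : weakly_summing (fun i => l (widen_ord (leqnSn n) i)).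
  move=> L L1; apply: le_trans (lw L L1).
  by rewrite [leRHS]big_ord_recr lerDl powR_ge0.
apply: le_trans (pq_norm_ub x lw').
rewrite /pnorm big_ord_recr/= ffun_rcons_max linear0 rnorm0.
rewrite powR0 ?gt_eqF// addr0.
by under [in leLHS]eq_bigr do rewrite ffun_rcons_widen.
Qed.

Lemma pq_norm_rcons_last n (x : {ffun 'I_n.+1 -> E}) :
  N (ffun_rcons x (x ord_max)) = N x.
Proof.
apply/le_anti; rewrite pq_norm_rcons_ge andbT; apply: pq_norm_le => l lw.
(* The family has n + 2 members: [l (w' ord_max)] and [l ord_max] are the last two, [l (w' (w i))]
   the first n. *)
pose w := widen_ord (leqnSn n); pose w' := widen_ord (leqnSn n.+1).
have [h [hx hL]] :=
  combine_functionals (l (w' ord_max)) (l ord_max) (x ord_max).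
pose k := ffun_rcons [ffun i => l (w' (w i))] h.
have kw : weakly_summing k.
  move=> L L1; apply: le_trans (lw L L1).
  rewrite big_ord_recr [leRHS]big_ord_recr/= [in leRHS]big_ord_recr/=.
  rewrite -addrA lerD//; last by rewrite /k ffun_rcons_max hL.
  by apply: ler_sum => i _; rewrite /k ffun_rcons_widen ffunE.
apply: le_trans (pq_norm_ub x kw).
rewrite /pnorm ge0_ler_powR ?nnegrE ?sum_powR_ge0 ?invr_ge0 ?(ltW q0)//.
rewrite big_ord_recr/= big_ord_recr/= [leRHS]big_ord_recr/= -addrA lerD//.
  by apply: ler_sum => i _; rewrite /k !ffun_rcons_widen ffunE.
rewrite /k !ffun_rcons_max ffun_rcons_widen hx -powRrM mulrC.
set s := rnorm _; set t := rnorm (l ord_max _).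
have powq z : z `^ q = (z `^ p) `^ (q / p).
  by rewrite -powRrM mulrC divfK// gt_eqF.
(* This is where p <= q enters: superadditivity of the power q/p >= 1, applied to s^p and t^p. *)
rewrite (powq s) (powq t) ler_powR_superadd ?powR_ge0//.
by rewrite ler_pdivlMr// mul1r.
Qed.

End PQNorm.

Theorem theorem4p1 (R : realType) (E : normedModType R[i]) (p q : R)
    (p_ge1 : 1 <= p) (p_le_q : p <= q) :
  (forall (n : nat) (x : {ffun 'I_n -> E}), (0 < n)%N ->
     pq_norm p q x \is a fin_num) /\
  multi_norm (fun (n : nat) (x : {ffun 'I_n -> E}) => fine (pq_norm p q x)).
Proof.
split=> [n x _|]; first exact: pq_norm_fin_num.
split.
- by move=> n _; exact: pq_norm_is_norm.
- exact: pq_norm1.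
- by move=> m s x; exact: pq_norm_perm.
(* The bound is the maximum of the |a_i|, nonnegative because it starts from 0. *)
- move=> m a x; apply: pq_norm_mul_le => // [|i].
    exact: bigmax_ge_id.
  exact: (le_bigmax _ _ i).
- by move=> m x; exact: pq_norm_rcons0.
- by move=> m x; exact: pq_norm_rcons_last.
Qed.
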